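(* Let $\theta,\sigma>0$, $\mu_k>0$, $q_k>0$, let $u_k(0)\in\mathbb{R}$, let $\xi_k$ ($k\ge1$) be i.i.d. standard normal random variables, and let $$u_k(t)=u_k(0)e^{-\theta\mu_kt}+\frac{\sigma q_k}{\theta\mu_k}\big(1-e^{-\theta\mu_kt}\big)\xi_k,\qquad U_k(t)=u_k(t)-u_k(0),\qquad t\ge0.$$ For $a>b>0$ let $F_{a,b}(x)=\dfrac{1-e^{-ax}}{1-e^{-bx}}$, $x\in(0,+\infty)$. Then, for every $t_2>t_1>0$ and every $k=1,2,\ldots$, $$\theta\mu_k=F^{-1}_{t_2,t_1}\left(\frac{U_k(t_2)}{U_k(t_1)}\right).$$
   Context: $F^{-1}_{t_2,t_1}$ denotes the inverse of the (strictly monotone) function $F_{t_2,t_1}$ on $(0,+\infty)$. The $u_k(t)$ are the Fourier coefficients of the solution of $\dot u+\theta Au=\sigma\sum_k q_k\xi_kh_k$ in a Hilbert space, with $Ah_k=\mu_kh_k$ and $\{h_k\}$ a complete orthonormal system.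
   Formalization: The identity is stated almost surely (one probability-one event serving all k and all t_2>t_1>0), since on the null event ξ_k = θμ_k u_k(0)/(σ q_k) one has U_k(t)=0 for all t and the ratio is 0/0. *)

(* Defs.v *)
From HB Require Import structures.
From mathcomp Require Import all_boot all_order all_algebra.
From mathcomp Require Import all_classical all_reals all_analysis.

Set Implicit Arguments.
Unset Strict Implicit.
Unset Printing Implicit Defensive.

Import Order.TTheory GRing.Theory Num.Theory.
Import numFieldNormedType.Exports.

Local Open Scope classical_set_scope.
Local Open Scope ring_scope.

(* Sequences indexed by k = 1, 2, ... are indexed here by nat, from 0. *)

Definition mutually_independent (d : measure_display) (T : measurableType d)
    (R : realType) (P : probability T R) (X : nat -> {RV P >-> R}) : Prop :=
  forall (s : seq nat) (A : nat -> set R),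
    uniq s -> (forall i, measurable (A i)) ->
    P (\bigcap_(i in [set` s]) (X i @^-1` A i)) =
    (\prod_(i <- s) P (X i @^-1` A i))%E.

Definition iid_standard_normal (d : measure_display) (T : measurableType d)
    (R : realType) (P : probability T R) (X : nat -> {RV P >-> R}) : Prop :=
  mutually_independent X /\
  forall (k : nat) (A : set R), measurable A ->
    distribution P (X k) A = normal_prob 0 1 A.

Definition fourier_coef (T : Type) (R : realType) (theta sigma : R)
    (mu q u0 : nat -> R) (xi : nat -> T -> R) (k : nat) (t : R) (omega : T) : R :=
  u0 k * expR (- (theta * mu k * t)) +
  sigma * q k / (theta * mu k) * (1 - expR (- (theta * mu k * t))) * xi k omega.

Definition fourier_incr (T : Type) (R : realType) (theta sigma : R)
    (mu q u0 : nat -> R) (xi : nat -> T -> R) (k : nat) (t : R) (omega : T) : R :=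
  fourier_coef theta sigma mu q u0 xi k t omega -
  fourier_coef theta sigma mu q u0 xi k 0 omega.

Definition Fratio (R : realType) (a b x : R) : R :=
  (1 - expR (- (a * x))) / (1 - expR (- (b * x))).

(* Inverse of [Fratio a b] as a function on (0, +oo).  Outside the image of
   (0, +oo) it takes the value 0, which is not in (0, +oo). *)
Definition Fratio_inv (R : realType) (a b : R) : R -> R :=
  'pinv_(fun=> 0) `]0, +oo[ (Fratio a b).

(* Main.v *)
(* The increment [U_k(t)] is [1 - exp(-theta mu_k t)] times a random factor
   independent of [t], which is almost surely nonzero because the normal law has
   no atoms.  Off the countable union of these null events, the quotient is
   [F_{t2,t1}(theta mu_k)] for all [k, t1, t2], and [F_{t2,t1}] is injective. *)

Require Import Defs.
From HB Require Import structures.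
From mathcomp Require Import all_boot all_order all_algebra.
From mathcomp Require Import all_classical all_reals all_analysis.
From mathcomp Require Import ring.

Set Implicit Arguments.
Unset Strict Implicit.
Unset Printing Implicit Defensive.

Import Order.TTheory GRing.Theory Num.Theory.
Import numFieldNormedType.Exports.

Local Open Scope classical_set_scope.
Local Open Scope ring_scope.

(* If [F_{a,b}] took the value [c] at [x < y], the function
   [1 - exp(-as) - c (1 - exp(-bs))] would vanish at [0], [x] and [y]; by Rolle,
   [a exp(-(a-b)s) = c b] would then hold at two distinct points [s]. *)
Lemma Fratio_inj (R : realType) (a b : R) : 0 < b -> b < a ->
  {in `]0, +oo[%classic &, injective (Fratio a b)}.
Proof.
move=> b_gt0 ltba x y; wlog ltxy : x y / x < y => [hw x_gt0 y_gt0 Fxy|].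
  have [ltxy|ltyx|//] := ltgtP x y; first exact: hw.
  by apply/esym/hw.
rewrite !inE/= !in_itv/= !andbT => x_gt0 y_gt0 Fxy; exfalso.
set c := Fratio a b x.
pose g s : R := 1 - expR (- (a * s)) - c * (1 - expR (- (b * s))).
(* Clearing the denominator is legitimate: [1 - expR (- (b * z))] is positive for [z > 0]. *)
have g_eq0 z : 0 < z -> Fratio a b z = c -> g z = 0.
  rewrite /g => z_gt0 <-; rewrite /Fratio divfK ?subrr// gt_eqF// subr_gt0.
  by rewrite -expR0 ltr_expR oppr_lt0 mulr_gt0.
have g00 : g 0 = 0 by rewrite /g !mulr0 oppr0 expR0 subrr mulr0 subr0.
have dg (z : R) : is_derive z 1 g (a * expR (- (a * z)) - c * (b * expR (- (b * z)))).
  apply: is_derive_eq; rewrite /GRing.scale/=; ring.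
have cg u v : {within `[u, v], continuous g}.
  by apply: continuous_subspaceT => z; apply/differentiable_continuous/derivable1_diffP.
have rolle u v : u < v -> g u = g v ->
    exists2 s, u < s < v & a * expR (- ((a - b) * s)) = c * b.
  move=> ltuv guv.
  have [//|s] := Rolle ltuv _ (cg u v) guv.
  rewrite in_itv/= => suv gs; exists s => //.
  have := @derive_val _ _ _ _ _ _ _ gs; rewrite (@derive_val _ _ _ _ _ _ _ (dg s)).
  (* Pulling the positive factor [expR (- (b * s))] out of the derivative leaves an equation with a
     single exponential. *)
  have -> : - (a * s) = - ((a - b) * s) + - (b * s) by ring.
  rewrite expRD !mulrA -mulrBl => /eqP; rewrite mulf_eq0 (gt_eqF (expR_gt0 _)) orbF.
  by rewrite subr_eq0 => /eqP.
have gx := g_eq0 x x_gt0 erefl; have gy := g_eq0 y y_gt0 (esym Fxy).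
(* The two critical points lie on either side of [x], so [s < x < t]; comparing their equations
   eliminates [c * b], and [a - b != 0] then forces [s = t]. *)
have [||s /andP[_ ltsx] es] := rolle 0 x => //; first by rewrite g00.
have [||t /andP[ltxt _] et] := rolle x y => //; first by rewrite gx.
have := lt_trans ltsx ltxt; suff -> : s = t by rewrite ltxx.
have a_gt0 := lt_trans b_gt0 ltba.
move: es; rewrite -et => /(mulfI (lt0r_neq0 a_gt0)) /expR_inj /oppr_inj.
by apply: mulfI; rewrite subr_eq0 gt_eqF.
Qed.

Lemma fourier_incrE (T : Type) (R : realType) (theta sigma : R)
    (mu q u0 : nat -> R) (xi : nat -> T -> R) (k : nat) (t : R) (omega : T) :
  fourier_incr theta sigma mu q u0 xi k t omega =
  (1 - expR (- (theta * mu k * t))) *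
  (sigma * q k / (theta * mu k) * xi k omega - u0 k).
Proof. by rewrite /fourier_incr /fourier_coef mulr0 oppr0 expR0; ring. Qed.

(** The normal law is absolutely continuous with respect to Lebesgue measure, which does not charge
    singletons. *)
Lemma normal_rv_ae_neq (R : realType) (d : measure_display) (T : measurableType d)
    (P : probability T R) (X : {RV P >-> R}) (c : R) :
  (forall A : set R, measurable A -> distribution P X A = normal_prob 0 1 A) ->
  {ae P, forall omega, X omega != c}.
Proof.
move=> X_normal; exists (X @^-1` [set c]); split.
- by rewrite -[X @^-1` _]setTI; exact: measurable_funPT.
- have := X_normal _ (measurable_set1 c); rewrite /distribution/pushforward/= => ->.
  apply: (iffLR (measure0_null_setP (normal_prob 0 1) (measurable_set1 c))).
  apply: normal_prob_dominates.
  apply: (iffRL (measure0_null_setP lebesgue_measure (measurable_set1 c))).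
  exact: lebesgue_measure_set1.
- by move=> omega /= /negP; rewrite negbK => /eqP.
Qed.

Theorem theorem3p2 (R : realType) (d : measure_display) (T : measurableType d)
    (P : probability T R) (theta sigma : R) (mu q u0 : nat -> R)
    (xi : nat -> {RV P >-> R})
    (theta_gt0 : 0 < theta) (sigma_gt0 : 0 < sigma)
    (mu_gt0 : forall k, 0 < mu k) (q_gt0 : forall k, 0 < q k)
    (xi_iid : iid_standard_normal xi) :
  {ae P, forall omega, forall (k : nat) (t1 t2 : R), 0 < t1 -> t1 < t2 ->
    theta * mu k =
    Fratio_inv t2 t1
      (fourier_incr theta sigma mu q u0 xi k t2 omega /
       fourier_incr theta sigma mu q u0 xi k t1 omega)}.
Proof.
have [_ xi_normal] := xi_iid.
(* The excluded value of [xi k] is the root of the random factor in [fourier_incrE]. It does not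
   involve time, so countably many null sets, one per [k], serve all pairs [t1], [t2] at once. *)
apply: filterS (ae_foralln (fun k =>
  normal_rv_ae_neq (u0 k / (sigma * q k / (theta * mu k))) (xi_normal k))).
move=> omega xi_neq k t1 t2 t1_gt0 lt12.
have tm_gt0 : 0 < theta * mu k by rewrite mulr_gt0.
set x := theta * mu k in tm_gt0 *.
have c_neq0 : sigma * q k / x != 0.
  by rewrite gt_eqF// divr_gt0// mulr_gt0.
have xi_incr_neq0 : sigma * q k / x * xi k omega - u0 k != 0.
  apply: contraNneq (xi_neq k) => /eqP; rewrite subr_eq0 => /eqP <-.
  by rewrite [_ * xi k omega]mulrC mulfK.
(* The nonzero random factor cancels, leaving [Fratio t2 t1 x] with [x > 0]; there the partial
   inverse is a true left inverse and its default value does not occur. *)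
rewrite !fourier_incrE -/x -mulf_div divff// mulr1.
rewrite (mulrC x t1) (mulrC x t2) -/(Fratio t2 t1 x) /Fratio_inv pinvKV//.
  exact: Fratio_inj.
by rewrite inE/= in_itv/= andbT.
Qed.
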